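(* Let $a,b\ge 3$ and $k\ge 2$ be integers and let $G=CB(k,a,b)$ be the cycle barbell. Then \begin{align*} \mathscr{K}_v(G)=\frac{1}{a+b+k-1}\Bigg[&\frac{(a+1)(a-1)}{6}\bigl(a+2(b+k-1)\bigr)+\frac{(b+1)(b-1)}{6}\bigl(b+2(a+k-1)\bigr)\\ &+(a+b)(k-1)^2+\frac{(k-1)(2k^2-4k+3)}{6}+2ab(k-1)\Bigg]. \end{align*}
   Context: The cycle barbell $CB(k,a,b)$ is the graph obtained from a cycle $C_a$, a path $P_k$ on $k$ vertices and a cycle $C_b$ by identifying one endpoint of the path with a vertex of $C_a$ and the other endpoint with a vertex of $C_b$. It has $a+b+k-2$ vertices and $a+b+k-1$ edges. The vertex Kemeny's constant $\mathscr{K}_v(G)$ is Kemeny's constant of the simple random walk on the vertices of $G$ (transition matrix $D^{-1}A$): if this matrix has eigenvalues $1=\rho_1,\rho_2,\dots,\rho_n$, then $\mathscr{K}_v(G)=\sum_{i=2}^n\frac{1}{1-\rho_i}$; equivalently $\sum_{j\ne i}\pi_j m_{ij}$ with $\pi$ the stationary distribution and $m_{ij}$ mean first passage times. *)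

(* Defs.v *)
From HB Require Import structures.
From mathcomp Require Import all_boot all_order all_algebra all_field.
Set Implicit Arguments. Unset Strict Implicit. Unset Printing Implicit Defensive.
Import Order.TTheory GRing.Theory Num.Theory.
Local Open Scope ring_scope.

(* Cycle barbell CB(k,a,b) on vertex set 'I_(a+b+k-2), labelled as follows:
   - C_a : vertices 0,1,...,a-1 with edges i~i+1 (i < a-1) and 0~(a-1);
   - P_k : vertices a-1, a, ..., a+k-2 (its endpoint a-1 is identified with
           a vertex of C_a) with edges i~i+1;
   - C_b : vertices a+k-2, ..., a+b+k-3 (its vertex a+k-2 is identified with
           the other endpoint of P_k) with edges i~i+1 and (a+k-2)~(a+b+k-3).
   Altogether: the consecutive edges i~i+1 (0 <= i < n-1) plus the two
   "closing" edges {0, a-1} and {a+k-2, n-1}, with n = a+b+k-2. *)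
Definition cb_n (k a b : nat) : nat := (a + b + k - 2)%N.

Definition cb_edge (k a b : nat) (i j : nat) : bool :=
  let n := cb_n k a b in
  [|| (j == i.+1) && (j < n)%N, (i == j.+1) && (i < n)%N,
      [&& i == 0%N, j == a.-1 & (j < n)%N], [&& j == 0%N, i == a.-1 & (i < n)%N],
      [&& i == (a + k - 2)%N, j == n.-1 & (i < j)%N]
    | [&& j == (a + k - 2)%N, i == n.-1 & (j < i)%N]].

Definition cb_adj (k a b : nat) : rel 'I_(cb_n k a b) :=
  fun i j => cb_edge k a b i j.

Definition cb_deg (k a b : nat) (i : 'I_(cb_n k a b)) : nat :=
  #|[set j | @cb_adj k a b i j]|.

Definition cb_trans (k a b : nat) : 'M[algC]_(cb_n k a b) :=
  \matrix_(i, j) ((@cb_adj k a b i j)%:R / (@cb_deg k a b i)%:R).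

Definition eigenvalues (n : nat) (M : 'M[algC]_n) : seq algC :=
  sval (closed_field_poly_normal (char_poly M)).

Definition kemeny (n : nat) (P : 'M[algC]_n) : algC :=
  \sum_(r <- rem 1 (eigenvalues P)) (1 - r)^-1.

Definition vertex_kemeny_cb (k a b : nat) : algC := kemeny (cb_trans k a b).

(* Main.v *)
Require Import Defs.
From HB Require Import structures.
From mathcomp Require Import all_boot all_order all_algebra all_field.
From mathcomp Require Import ring zify.
Import Order.TTheory GRing.Theory Num.Theory.
Local Open Scope ring_scope.

(* Let [L = D - A] be the Laplacian, [P = D^-1 A], and [vol] the sum of the
   degrees.  If [L Gam = I - tau 1^T] for some column [tau], then correcting
   [Gam] by a multiple of [1^T] and scaling by [D] yields a [G] with
   [(I - P) G = I - 1 w] and [G 1 = 0], which forces Kemeny's constant to be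
   [tr G = sum_i d_i Gam_ii - (sum_ij d_i Gam_ij d_j) / vol].
   The barbell is the path [0 - 1 - ... - (n-1)] with two extra edges, so its
   Green function grounded at [0] is that of the path, [min(i, j)], minus one
   rank-one correction per extra edge; the degrees are [2], plus [1] at the two
   glued vertices.  Kemeny's constant is then a combination of power sums. *)

(** * Kemeny's constant as a trace, through determinants and Green functions *)

Lemma horner_deriv_prod (F : fieldType) (I : Type) (s : seq I)
    (p : I -> {poly F}) (x : F) :
  (\prod_(i <- s) p i).[x] != 0 ->
  (\prod_(i <- s) p i)^`().[x] =
  (\prod_(i <- s) p i).[x] * \sum_(i <- s) (p i)^`().[x] / (p i).[x].
Proof.
elim: s => [|i s IHs]; first by rewrite !big_nil derivC horner0 mulr0.
rewrite !big_cons derivM hornerD !hornerM mulf_eq0 negb_or => /andP[pi0 ps0].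
by rewrite (IHs ps0); field.
Qed.

(** Sylvester's identity: both sides are the determinant of the block matrix with rows [1, u] and
    [-v, 1], factored by eliminating either off-diagonal block. *)
Lemma det_add1_mulmx (R : comNzRingType) (m n : nat)
    (u : 'M[R]_(m, n)) (v : 'M[R]_(n, m)) :
  \det (1%:M + u *m v) = \det (1%:M + v *m u).
Proof.
have <- : \det (block_mx 1%:M u (- v) 1%:M) = \det (1%:M + u *m v).
  have <- : block_mx (1%:M + u *m v) u 0 1%:M *m block_mx 1%:M 0 (- v) 1%:M
          = block_mx 1%:M u (- v) 1%:M.
    by rewrite mulmx_block !mulmx1 !mul1mx !mul0mx !mulmx0 !mulmxN addrK !add0r.
  by rewrite det_mulmx det_ublock det_lblock !det1 !mulr1.
have <- : block_mx 1%:M 0 (- v) 1%:M *m block_mx 1%:M u 0 (1%:M + v *m u)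
        = block_mx 1%:M u (- v) 1%:M.
  rewrite mulmx_block !mulmx1 !mul1mx !mul0mx !addr0 mulNmx.
  by rewrite addrCA addNr addr0.
by rewrite det_mulmx det_ublock det_lblock !det1 !mul1r.
Qed.

(** Schur triangularisation replaces [A] by a triangular [T] of the same trace, and the determinant
    becomes a product of affine factors equal to 1 at [x]. *)
Lemma horner_deriv_det_linear (C : numClosedFieldType) (n : nat) (A : 'M[C]_n)
    (x : C) (f := \det (1%:M + ('X - x%:P) *: map_mx polyC A)) :
  (f.[x] = 1) * (f^`().[x] = \tr A).
Proof.
case: n => [|n] in A f *.
  by rewrite /f det_mx00 /mxtrace big_ord0 derivC hornerC horner0.
have [Q Q_unitary] := @Schur C n.+1 A isT.
have Qu := unitarymx_unit Q_unitary.
rewrite /similar_to /= conjumx //.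
have [T TE] : exists T, T = Q *m A *m invmx Q by eexists.
rewrite -TE => trig_T.
have trT : \tr T = \tr A by rewrite TE mxtrace_mulC mulmxA mulVmx // mul1mx.
have fE : f = \prod_i (1 + ('X - x%:P) * (T i i)%:P).
  have -> : f = \det (1%:M + ('X - x%:P) *: map_mx polyC T).
    have Qpu : map_mx polyC Q *m map_mx polyC (invmx Q) = 1%:M.
      by rewrite -map_mxM mulmxV // map_mx1.
    have -> : 1%:M + ('X - x%:P) *: map_mx polyC T
        = map_mx polyC Q *m (1%:M + ('X - x%:P) *: map_mx polyC A)
          *m map_mx polyC (invmx Q).
      by rewrite mulmxDr mulmxDl mulmx1 Qpu -scalemxAr -scalemxAl TE !map_mxM.
    by rewrite !det_mulmx mulrAC -det_mulmx Qpu det1 mul1r.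
  rewrite det_trig; first by apply: eq_bigr => i _; rewrite !mxE eqxx.
  apply/is_trig_mxP => i j ij; rewrite !mxE.
  by rewrite (is_trig_mxP trig_T) // mulr0 addr0 -val_eqE (ltn_eqF ij).
have fx1 : f.[x] = 1.
  by rewrite fE horner_prod big1 // => i _; rewrite !hornerE subrr mul0r addr0.
split=> //; have := fx1; rewrite fE => fx1'.
rewrite horner_deriv_prod fx1' ?oner_neq0 // mul1r -trT.
apply: eq_bigr => i _.
by rewrite !derivE !hornerE subrr !mul0r !addr0 divr1.
Qed.

(* With [y = X - 1], [(X - P) (G + 1 w) = (1 + y G) (1 + (y - 1) 1 w)] gives
   [c * char_poly P = y * det (1 + y G)] for a constant [c]. *)
Lemma kemeny_mxtrace (n : nat) (P G : 'M[algC]_n.+1) (w : 'rV[algC]_n.+1)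
    (u := const_mx 1 : 'cV[algC]_n.+1) :
  P *m u = u -> G *m u = 0 -> (1%:M - P) *m G = 1%:M - u *m w ->
  kemeny P = \tr G.
Proof.
move=> Pu Gu PG.
have wu : w *m u = 1%:M.
  have : (1%:M - P) *m G *m u = 0 by rewrite -mulmxA Gu mulmx0.
  rewrite PG mulmxBl mul1mx -mulmxA => /eqP; rewrite subr_eq0 => /eqP.
  move=> /matrixP/(_ 0 0); rewrite !mxE big_ord1 !mxE mul1r => wu1.
  by apply/matrixP => i j; rewrite !ord1 !mxE eqxx /= wu1.
pose y : {poly algC} := 'X - 1%:P.
pose f := \det (1%:M + y *: map_mx polyC G).
pose c := \det (G + u *m w).
have charP : char_poly P * c%:P = f * y.
  have := congr1 (map_mx polyC) PG; have := congr1 (map_mx polyC) Gu.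
  have := congr1 (map_mx polyC) Pu; have := congr1 (map_mx polyC) wu.
  rewrite !(map_mxM, map_mxB, map_mx1, map_mx0) /= => wu' Pu' Gu' PG'.
  rewrite /c -det_map_mx /= map_mxD map_mxM /char_poly -det_mulmx.
  set u' := map_mx _ u in wu' Pu' Gu' PG' *.
  set w' := map_mx _ w in wu' Pu' Gu' PG' *.
  set G' := map_mx _ G in wu' Pu' Gu' PG' *.
  (* Sylvester's identity reduces this determinant to the scalar [1 + (y - 1) * (w u) = y]. *)
  have -> : y = \det (1%:M + u' *m ((y - 1) *: w')).
    by rewrite det_add1_mulmx -scalemxAl wu' scalemx1 -raddfD det_mx11 mxE
       eqxx mulr1n addrC subrK.
  rewrite -det_mulmx; congr (\det _).
  have -> : char_poly_mx P = y%:M + (1%:M - map_mx polyC P).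
    by rewrite /char_poly_mx addrA -raddfD subrK.
  rewrite mulmxDl !mulmxDr PG' !mul_scalar_mx mulmxBl mul1mx.
  rewrite [map_mx polyC P *m _]mulmxA Pu' subrr addr0 -/G' mulmx1.
  rewrite mulmxDl mul1mx -scalemxAl mulmxA -!scalemxAr Gu' mul0mx !scaler0.
  rewrite addr0 [(y - 1) *: _]scalerBl scale1r !addrA; congr (_ - _).
  by rewrite addrC addrA.
have [f1 df1] := @horner_deriv_det_linear algC n.+1 G 1.
rewrite -/y -/f in f1 df1.
rewrite /kemeny /eigenvalues; case: closed_field_poly_normal => s /= sE.
have /monicP lc := char_poly_monic P; rewrite lc scale1r in sE.
have s1 : 1 \in s.
  rewrite -root_prod_XsubC -sE /root.
  have c0 : c != 0.
    apply: contra_eq_neq charP => ->; rewrite mulr0 eq_sym mulf_neq0 //.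
      by apply: contra_eq_neq f1 => ->; rewrite horner0 eq_sym oner_neq0.
    by rewrite polyXsubC_eq0.
  have := congr1 (horner^~ 1) charP; rewrite !hornerE subrr mulr0 => /eqP.
  by rewrite mulf_eq0 (negPf c0) orbF.
rewrite (perm_big _ (perm_to_rem s1)) /= big_cons -/y in sE.
move: sE; set q := \prod_(r <- _) _ => sE.
have y0 : y != 0 by rewrite /y polyXsubC_eq0.
have qf : q * c%:P = f.
  by apply: (mulfI y0); rewrite mulrA -sE charP mulrC.
have q1 : q.[1] * c = 1 by rewrite -[RHS]f1 -qf hornerM hornerC.
have q0 : q.[1] != 0.
  by apply: contra_eq_neq q1 => ->; rewrite mul0r eq_sym oner_neq0.
have := df1; rewrite -qf derivM derivC mulr0 addr0 hornerM hornerC.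
rewrite horner_deriv_prod // -/q mulrAC q1 mul1r => <-.
by apply: eq_bigr => r _; rewrite !derivE !hornerE.
Qed.

(** The last hypothesis is [L Gam = I - tau 1^T] read entrywise. As [tau] is absent from the
    conclusion, the choice of grounding is free. *)
Lemma kemeny_green (n : nat) (A Gam : 'M[algC]_n) (tau : 'I_n -> algC)
    (d := fun i => \sum_j A i j) (vol := \sum_i d i) :
  (forall i, d i != 0) -> vol != 0 ->
  (forall i j, \sum_k A i k * (Gam i j - Gam k j) = (i == j)%:R - tau i) ->
  kemeny (\matrix_(i, j) (A i j / d i)) =
  \sum_i d i * Gam i i - (\sum_i \sum_j d i * Gam i j * d j) / vol.
Proof.
case: n => [|n] in A Gam tau d vol *; first by rewrite /vol big_ord0 eqxx.
move=> d0 vol0 LGam; set P := \matrix_(i, j) _.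
(* [h] averages each row of [Gam] against the weights [d / vol]. Subtracting it gives [G 1 = 0], and
   [L h = d / vol - tau] makes [tau] cancel, leaving [w = d / vol]. *)
pose h i := (\sum_k Gam i k * d k) / vol.
pose G : 'M[algC]_n.+1 := \matrix_(i, j) ((Gam i j - h i) * d j).
have Lh i : \sum_k A i k * (h i - h k) = d i / vol - tau i.
  have -> : \sum_k A i k * (h i - h k)
      = (\sum_j (\sum_k A i k * (Gam i j - Gam k j)) * d j) / vol.
    under [X in _ = X / _]eq_bigr do rewrite mulr_suml.
    rewrite exchange_big mulr_suml; apply: eq_bigr => k _ /=.
    rewrite /h -mulrBl -sumrB mulrA mulr_sumr; congr (_ / _).
    by apply: eq_bigr => j _; rewrite -mulrBl mulrA.
  under eq_bigr do rewrite LGam mulrBl.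
  rewrite sumrB -mulr_sumr -/vol (bigD1 i) //= eqxx mul1r big1 ?addr0.
    by rewrite mulrBl mulfK.
  by move=> j /negPf ji; rewrite eq_sym ji mul0r.
have -> : \sum_i d i * Gam i i - (\sum_i \sum_j d i * Gam i j * d j) / vol
    = \tr G.
  rewrite mulr_suml -sumrB; apply: eq_bigr => i _.
  rewrite mxE mulrBl mulrC; congr (_ - _).
  rewrite /h [RHS]mulrC mulrA mulr_sumr; congr (_ / _).
  by apply: eq_bigr => j _; rewrite mulrA.
apply: (@kemeny_mxtrace n P G (\row_j (d j / vol))).
- apply/colP => i; rewrite !mxE.
  under eq_bigr do rewrite !mxE mulr1.
  by rewrite -mulr_suml; exact: divff (d0 i).
- apply/colP => i; rewrite !mxE.
  under eq_bigr do rewrite !mxE mulr1 mulrBl.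
  by rewrite sumrB -mulr_sumr -/vol /h divfK // subrr.
- apply/matrixP => i j; rewrite mulmxBl mul1mx !mxE big_ord1 !mxE mul1r.
  have -> : \sum_k P i k * G k j
      = (Gam i j - h i) * d j - (\sum_k A i k * (Gam i j - Gam k j)
                  - \sum_k A i k * (h i - h k)) / d i * d j.
    rewrite -sumrB -mulrBl.
    have -> : Gam i j - h i = (\sum_k A i k * (Gam i j - h i)) / d i.
      by rewrite -mulr_suml mulrC mulKf.
    rewrite -mulrBl -sumrB !mulr_suml; apply: eq_bigr => k _.
    by rewrite !mxE; ring.
  rewrite LGam Lh; case: eqVneq => [<-|_] /=.
    by rewrite mulr1n; field; rewrite vol0 d0.
  by rewrite mulr0n; field; rewrite vol0 d0.
Qed.

Lemma sum_ord_eq (R : pzSemiRingType) (n c : nat) (f : nat -> R) :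
  \sum_(j < n) (val j == c)%:R * f j = (c < n)%:R * f c.
Proof.
case: ltnP => [cn|nc].
  rewrite (bigD1 (Ordinal cn)) //= eqxx big1 ?addr0 // => j.
  by rewrite -val_eqE /= => /negPf ->; rewrite mul0r.
rewrite mul0r big1 // => j _.
by rewrite ltn_eqF ?mul0r // (leq_trans (ltn_ord j)).
Qed.

(** * Sums of first and second powers, also truncated by [minn] or [subn] *)

Section PowerSums.

Variable F : numFieldType.

Lemma sum_ord_id (c : nat) :
  \sum_(i < c) (i%:R : F) = c%:R * (c%:R - 1) / 2%:R.
Proof.
elim: c => [|c IHc]; first by rewrite big_ord0 !mul0r.
by rewrite big_ord_recr /= IHc; field.
Qed.

Lemma sum_ord_sqr (c : nat) :
  \sum_(i < c) (i%:R ^+ 2 : F) = c%:R * (c%:R - 1) * (2%:R * c%:R - 1) / 6%:R.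
Proof.
elim: c => [|c IHc]; first by rewrite big_ord0 !mul0r.
by rewrite big_ord_recr /= IHc; field.
Qed.

Lemma sum_minn (x c : nat) :
  \sum_(i < x + c) ((minn i x)%:R : F) = x%:R * (x%:R - 1) / 2%:R + c%:R * x%:R.
Proof.
elim: c => [|c IHc].
  rewrite addn0 mul0r addr0 -sum_ord_id; apply: eq_bigr => i _.
  by rewrite (minn_idPl (ltnW (ltn_ord i))).
by rewrite addnS big_ord_recr /= IHc (minn_idPr (leq_addr _ _)); ring.
Qed.

Lemma sum_minn_sqr (x c : nat) :
  \sum_(i < x + c) ((minn i x)%:R ^+ 2 : F)
  = x%:R * (x%:R - 1) * (2%:R * x%:R - 1) / 6%:R + c%:R * x%:R ^+ 2.
Proof.
elim: c => [|c IHc].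
  rewrite addn0 mul0r addr0 -sum_ord_sqr; apply: eq_bigr => i _.
  by rewrite (minn_idPl (ltnW (ltn_ord i))).
by rewrite addnS big_ord_recr /= IHc (minn_idPr (leq_addr _ _)); ring.
Qed.

Lemma sum_subn (x c : nat) :
  \sum_(i < x + c) ((i - x)%:R : F) = c%:R * (c%:R - 1) / 2%:R.
Proof.
(* Truncated subtraction makes the first [x] terms zero. *)
rewrite big_split_ord /= big1 => [|i _]; last first.
  by rewrite (eqP (ltnW (ltn_ord i))).
by rewrite add0r -sum_ord_id; apply: eq_bigr => i _; rewrite addKn.
Qed.

Lemma sum_subn_sqr (x c : nat) :
  \sum_(i < x + c) ((i - x)%:R ^+ 2 : F)
  = c%:R * (c%:R - 1) * (2%:R * c%:R - 1) / 6%:R.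
Proof.
rewrite big_split_ord /= big1 => [|i _]; last first.
  by rewrite (eqP (ltnW (ltn_ord i))) expr0n.
by rewrite add0r -sum_ord_sqr; apply: eq_bigr => i _; rewrite addKn.
Qed.

End PowerSums.

(** * Adjacency, Green function and degrees of the barbell *)

Section Barbell.

Variables u p b : nat.
Hypotheses (u2 : (2 <= u)%N) (p1 : (1 <= p)%N) (b3 : (3 <= b)%N).
(** With [a = u + 1] and [k = p + 1], the glued vertices are [u] and [v]; the closing edges are
    [{0, u}] and [{v, w}], where [w] is the last vertex. *)
Let v := (u + p)%N.
Let n := cb_n p.+1 u.+1 b.
Let nE : n = (u + p + b)%N.
Proof. by rewrite /n /cb_n; lia. Qed.
Let w := n.-1.

(** The alternatives exclude one another, so the disjunction is a sum: [u >= 2] and [v + 1 < w] keep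
    the closing edges off the path. The guard [0 < i] discards the spurious case [0.-1 = 0]. *)
Lemma cb_edge_natE (i j : nat) : (i < n)%N -> (j < n)%N ->
  (cb_edge p.+1 u.+1 b i j : nat) =
  ((j == i.+1) + ((0 < i) && (j == i.-1)) + ((i == 0) && (j == u))
   + ((i == u) && (j == 0)) + ((i == v) && (j == w)) + ((i == w) && (j == v)))%N.
Proof.
move=> ltin ltjn; rewrite /cb_edge -/n ltin ltjn /= -/w !andbT.
have -> : (u.+1 + p.+1 - 2)%N = v by rewrite /v; lia.
have wE : w = (v + b).-1 by rewrite /w /v nE.
have uv : (u < v)%N by rewrite /v; lia.
have vw : (v.+1 < w)%N by lia.
have -> : (i == j.+1) = (0 < i)%N && (j == i.-1) by lia.
have -> : [&& i == v, j == w & (i < j)%N] = (i == v) && (j == w) by lia.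
have -> : [&& j == v, i == w & (j < i)%N] = (i == w) && (j == v) by lia.
have -> : (j == 0%N) && (i == u) = (i == u) && (j == 0%N) by rewrite andbC.
clearbody v w; clear n nE ltin ltjn wE.
have [-> | i0] := eqVneq i 0%N; [|have [-> | iu] := eqVneq i u;
  [|have [-> | iv] := eqVneq i v; [|have [-> | iw] := eqVneq i w]]].
- have [-> -> ->] : [/\ (0 == u)%N = false, (0 == v)%N = false
                     & (0 == w)%N = false] by split; lia.
  by rewrite /=; do 2!case: eqP => ? //=; lia.
- have [-> -> ->] : [/\ (0 < u)%N, (u == v) = false & (u == w) = false].
    by split; lia.
  by rewrite /=; do 3!case: eqP => ? //=; lia.
- have [-> ->] : (0 < v)%N /\ (v == w) = false by split; lia.
  by rewrite /=; do 3!case: eqP => ? //=; lia.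
- have -> : (0 < w)%N by lia.
  by rewrite /=; do 3!case: eqP => ? //=; lia.
rewrite lt0n i0 /= !orbF !addn0.
by do 2!case: eqP => ? //=; lia.
Qed.

Lemma sum_cb_edge (i : nat) (f : nat -> algC) : (i < n)%N ->
  \sum_(j < n) (cb_edge p.+1 u.+1 b i j)%:R * f j =
  (i.+1 < n)%:R * f i.+1 + (0 < i)%:R * f i.-1 + (i == 0)%:R * f u
  + (i == u)%:R * f 0 + (i == v)%:R * f w + (i == w)%:R * f v.
Proof.
move=> ltin; under eq_bigr => j _.
  rewrite cb_edge_natE // !natrD !mulrDl.
  over.
rewrite !big_split /=.
have ind (c : bool) (x : nat) : (c -> x < n)%N ->
    \sum_(j < n) (c && (val j == x))%:R * f j = c%:R * f x.
  case: c => [/(_ isT) xn|_]; first by rewrite sum_ord_eq xn.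
  by rewrite mul0r big1 // => j _; rewrite mul0r.
by rewrite sum_ord_eq !ind //; move: ltin; rewrite /w /v nE; lia.
Qed.

Let m (i j : nat) : algC := (minn i j)%:R.

(** [minn] climbs by one per step up to [j] and is then flat, so the two differences cancel except
    at [j] and at [0], which has no left neighbour. The missing right neighbour of the last vertex
    costs nothing because [j < n]. *)
Lemma path_laplacian_min (i j : nat) : (i < n)%N -> (j < n)%N ->
  (i.+1 < n)%:R * (m i j - m i.+1 j) + (0 < i)%:R * (m i j - m i.-1 j)
  = (i == j)%:R - (i == 0)%:R.
Proof.
move=> ltin ltjn.
have mS x : m x.+1 j = m x j + (x < j)%:R.
  by rewrite /m -natrD; congr _%:R; lia.
have -> : (i.+1 < n)%:R * (m i j - m i.+1 j) = - (i < j)%:R.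
  rewrite mS opprD addrA subrr sub0r.
  have [ij|_] := ltnP i j; last by rewrite oppr0 mulr0.
  by rewrite (leq_ltn_trans ij) // mul1r.
case: i {ltin} => [|i] /=.
  rewrite mul0r addr0 eq_sym.
  by case: (j) => [|?] /=; rewrite ?subrr ?oppr0 ?sub0r.
rewrite mS addrAC subrr add0r mul1r subr0.
by case: ltngtP; rewrite ?addNr ?oppr0 ?add0r.
Qed.

(** The plain [min] suffices here: the correction for [{0, u}] takes equal values at [v] and [w], as
    [m v u = m w u = u]. *)
Let beta (i : nat) : algC := m i w - m i v.

(* Adding a unit conductance between [x] and [y] to a network with Green
   function [g] subtracts from [g] the rank-one term [c i * c j / (1 + c x - c y)],
   where [c i := g i x - g i y]; start from the path grounded at [0], whose
   Green function is [min], and add the two closing edges. *)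
Let green (i j : nat) : algC :=
  m i j - m i u * m j u / u.+1%:R - beta i * beta j / b%:R.

Lemma green_laplacian (i j : nat) : (i < n)%N -> (j < n)%N ->
  \sum_(k < n) (cb_edge p.+1 u.+1 b i k)%:R * (green i j - green k j)
  = (i == j)%:R - (i == 0)%:R.
Proof.
move=> ltin ltjn; rewrite (sum_cb_edge i (fun k => green i j - green k j)) //.
have ltun : (u < n)%N by rewrite nE; lia.
have ltvn : (v < n)%N by rewrite /v nE; lia.
have ltwn : (w < n)%N by rewrite /w nE; lia.
have b0 : b%:R != 0 :> algC by rewrite pnatr_eq0; lia.
have a0 : u.+1%:R != 0 :> algC by rewrite pnatr_eq0.
(* The path Laplacian turns each rank-one term into a difference of indicators at the ends of its
   closing edge. *)
have path_green : (i.+1 < n)%:R * (green i j - green i.+1 j)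
    + (0 < i)%:R * (green i j - green i.-1 j)
  = ((i == j)%:R - (i == 0)%:R)
    - ((i == u)%:R - (i == 0)%:R) * m j u / u.+1%:R
    - ((i == w)%:R - (i == v)%:R) * beta j / b%:R.
  have -> : (i == w)%:R - (i == v)%:R
      = ((i == w)%:R - (i == 0)%:R) - ((i == v)%:R - (i == 0)%:R) :> algC.
    by ring.
  rewrite -!path_laplacian_min // /green /beta.
  by field; rewrite b0 nat1r a0.
rewrite path_green.
have m0 x : m 0 x = 0 by rewrite /m min0n.
(* The potential drops across the closing edges are [m j u / u.+1%:R] and [beta j / b%:R], exactly
   the coefficients left over by the path part. *)
have g0 : green 0 j = 0 by rewrite /green /beta !m0; ring.
have gu : green u j = m j u / u.+1%:R.
  rewrite /green /beta.
  have -> : m u u = u%:R by rewrite /m minnn.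
  have -> : m u w = u%:R by rewrite /m; congr _%:R; rewrite /w nE; lia.
  have -> : m u v = u%:R by rewrite /m; congr _%:R; rewrite /v; lia.
  by rewrite [m u j]/m minnC -/(m j u) subrr; field; rewrite b0 nat1r a0.
have gwv : green w j - green v j = beta j / b%:R.
  rewrite /green /beta.
  have -> : m w u = u%:R by rewrite /m; congr _%:R; rewrite /w nE; lia.
  have -> : m v u = u%:R by rewrite /m; congr _%:R; rewrite /v; lia.
  have -> : m v w = v%:R by rewrite /m; congr _%:R; rewrite /w /v nE; lia.
  have -> : m w v = v%:R by rewrite /m; congr _%:R; rewrite /w /v nE; lia.
  have -> : m w w = v%:R + b%:R - 1.
    rewrite -natrD (_ : (v + b)%N = w.+1); last by rewrite /w /v nE; lia.
    by rewrite -natr1 addrK /m minnn.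
  have -> : m v v = v%:R by rewrite /m minnn.
  rewrite [m w j]/m minnC -/(m j w) [m v j]/m minnC -/(m j v).
  by field; rewrite b0 nat1r a0.
have at_vertex x c :
    (i == c)%:R * (green i j - x) = (i == c)%:R * (green c j - x).
  by case: eqVneq => [->|] //; rewrite !mul0r.
rewrite (at_vertex _ 0) (at_vertex _ u) (at_vertex _ v) (at_vertex _ w).
rewrite g0 gu -[green v j - green w j]opprB gwv.
by field; rewrite b0 nat1r a0.
Qed.

Let deg (i : nat) : algC := 2%:R + (i == u)%:R + (i == v)%:R.

(** The path ends [0] and [w] lack one path neighbour each, which a closing edge restores. *)
Lemma sum_cb_edge_deg (i : nat) : (i < n)%N ->
  \sum_(j < n) (cb_edge p.+1 u.+1 b i j)%:R = deg i.
Proof.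
move=> ltin; under eq_bigr do rewrite -[_%:R]mulr1.
rewrite (sum_cb_edge i (fun=> 1)) // !mulr1 /deg.
have -> : (i.+1 < n)%:R = 1 - (i == w)%:R :> algC.
  have -> : (i == w) = ~~ (i.+1 < n)%N by rewrite /w; lia.
  by case: (_ < _)%N; rewrite /= ?subr0 ?subrr.
have -> : (0 < i)%:R = 1 - (i == 0%N)%:R :> algC.
  by case: (i) => [|?]; rewrite /= ?subr0 ?subrr.
ring.
Qed.

Lemma sum_deg_mul (f : nat -> algC) :
  \sum_(i < n) deg i * f i = 2%:R * (\sum_(i < n) f i) + f u + f v.
Proof.
have [ltun ltvn] : (u < n)%N /\ (v < n)%N by rewrite /v nE; lia.
under eq_bigr do rewrite /deg -addrA mulrDl [X in _ + X]mulrDl.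
by rewrite !big_split /= -mulr_sumr !sum_ord_eq ltun ltvn !mul1r addrA.
Qed.

Lemma betaE (i : nat) : (i < n)%N -> beta i = (i - v)%:R.
Proof.
move=> ltin; rewrite /beta /m (_ : minn i w = i)%N; last by rewrite /w; lia.
rewrite {1}(_ : i = minn i v + (i - v))%N; last by lia.
by rewrite natrD addrAC subrr add0r.
Qed.

(** The [deg]-weighted row sum of [min] is a quadratic in [i] plus [m i u + m i v], and each
    rank-one term factors into a square, so only single sums remain. *)
Lemma sum_green_deg :
  \sum_(i < n) \sum_(j < n) deg i * green i j * deg j =
    (2%:R * n%:R - 1) * (\sum_(i < n) deg i * i%:R)
  - \sum_(i < n) deg i * i%:R ^+ 2
  + \sum_(i < n) deg i * m i u + \sum_(i < n) deg i * m i v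
  - (\sum_(i < n) deg i * m i u) ^+ 2 / u.+1%:R
  - (\sum_(i < n) deg i * beta i) ^+ 2 / b%:R.
Proof.
have sum_m x : (x <= n)%N ->
    \sum_(j < n) m j x = x%:R * (x%:R - 1) / 2%:R + (n%:R - x%:R) * x%:R.
  by move=> lexn; have := sum_minn algC x (n - x); rewrite subnKC // natrB.
have green_row (i : 'I_n) : \sum_(j < n) deg i * green i j * deg j =
    deg i * ((2%:R * n%:R - 1) * i%:R - i%:R ^+ 2 + m i u + m i v)
  - deg i * m i u * ((\sum_(j < n) deg j * m j u) / u.+1%:R)
  - deg i * beta i * ((\sum_(j < n) deg j * beta j) / b%:R).
  have -> : (2%:R * n%:R - 1) * i%:R - i%:R ^+ 2 + m i u + m i v
      = \sum_(j < n) deg j * m j i :> algC.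
    rewrite (sum_deg_mul (fun j => m j i)).
    by rewrite sum_m ?(ltnW (ltn_ord i)) // /m (minnC u) (minnC v); field.
  rewrite !(mulr_suml, mulr_sumr) -!sumrB; apply: eq_bigr => j _.
  by rewrite /green {1}/m minnC -/(m j i); ring.
under eq_bigr do rewrite green_row.
rewrite !sumrB -!mulr_suml.
under eq_bigr do rewrite !mulrDr mulrN mulrCA.
rewrite !big_split /= -mulr_sumr sumrN.
by rewrite !mulrA -!expr2.
Qed.

Lemma kemeny_cb_green :
  vertex_kemeny_cb p.+1 u.+1 b =
  \sum_(i < n) deg i * green i i
  - (\sum_(i < n) \sum_(j < n) deg i * green i j * deg j) / \sum_(i < n) deg i.
Proof.
pose A : 'M[algC]_n := \matrix_(i, j) (cb_edge p.+1 u.+1 b i j)%:R.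
have dA (i : 'I_n) : \sum_j A i j = deg i.
  by rewrite -sum_cb_edge_deg //; apply: eq_bigr => j _; rewrite mxE.
have transE : cb_trans p.+1 u.+1 b = \matrix_(i, j) (A i j / \sum_j A i j).
  apply/matrixP => i j; rewrite !mxE; congr (_ / _).
  rewrite /cb_deg -sum1_card natr_sum big_mkcond /=.
  by apply: eq_bigr => k _; rewrite inE mxE /cb_adj; case: cb_edge.
have deg_gt0 i : 0 < deg i by rewrite /deg -!natrD ltr0n.
have n_gt0 : (0 < n)%N by rewrite nE; lia.
have vol_gt0 : 0 < \sum_(i < n) deg i.
  rewrite (bigD1 (Ordinal n_gt0)) //= ltr_wpDr // sumr_ge0 // => i _.
  exact: ltW.
rewrite /vertex_kemeny_cb transE.
(* Grounding at [0] makes [tau] the indicator of that vertex. *)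
rewrite (@kemeny_green n A (\matrix_(i, j) green i j)
          (fun i => (val i == 0)%:R)).
- under eq_bigr do rewrite dA mxE.
  congr (_ - _ / _); last by apply: eq_bigr => i _; rewrite dA.
  by apply: eq_bigr => i _; apply: eq_bigr => j _; rewrite !dA mxE.
- by move=> i; rewrite dA gt_eqF.
- by under eq_bigr do rewrite dA; rewrite gt_eqF.
- move=> i j; rewrite -val_eqE -(green_laplacian i j (ltn_ord i) (ltn_ord j)).
  by apply: eq_bigr => k _; rewrite !mxE.
Qed.

Lemma kemeny_cb_closed :
  vertex_kemeny_cb p.+1 u.+1 b =
  ((u.+1 + b + p.+1)%:R - 1)^-1 *
  ( (u.+1%:R + 1) * (u.+1%:R - 1) / 6%:R * (u.+1%:R + 2%:R * (b%:R + p.+1%:R - 1))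
  + (b%:R + 1) * (b%:R - 1) / 6%:R * (b%:R + 2%:R * (u.+1%:R + p.+1%:R - 1))
  + (u.+1%:R + b%:R) * (p.+1%:R - 1) ^+ 2
  + (p.+1%:R - 1) * (2%:R * p.+1%:R ^+ 2 - 4%:R * p.+1%:R + 3%:R) / 6%:R
  + 2%:R * u.+1%:R * b%:R * (p.+1%:R - 1) : algC).
Proof.
have [ltun ltvn] : (u < n)%N /\ (v < n)%N by rewrite /v nE; lia.
have W1 : \sum_(i < n) deg i * i%:R = n%:R * (n%:R - 1) + u%:R + v%:R.
  by rewrite (sum_deg_mul (fun i => i%:R)) sum_ord_id; field.
have W2 : \sum_(i < n) deg i * i%:R ^+ 2
    = n%:R * (n%:R - 1) * (2%:R * n%:R - 1) / 3%:R + u%:R ^+ 2 + v%:R ^+ 2.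
  by rewrite (sum_deg_mul (fun i => i%:R ^+ 2)) sum_ord_sqr; field.
have [muu mvu muv mvv] :
    [/\ m u u = u%:R, m v u = u%:R, m u v = u%:R & m v v = v%:R].
  by rewrite /m; split; congr _%:R; rewrite /v; lia.
have nE' : n = (u + (p + b))%N by rewrite nE addnA.
have Wu : \sum_(i < n) deg i * m i u
    = u%:R * (u%:R - 1) + 2%:R * (p%:R + b%:R) * u%:R + 2%:R * u%:R.
  by rewrite (sum_deg_mul (m^~ u)) muu mvu nE' sum_minn natrD; field.
have Wuu : \sum_(i < n) deg i * m i u ^+ 2
    = u%:R * (u%:R - 1) * (2%:R * u%:R - 1) / 3%:R
      + 2%:R * (p%:R + b%:R) * u%:R ^+ 2 + 2%:R * u%:R ^+ 2.
  rewrite (sum_deg_mul (fun i => m i u ^+ 2)) muu mvu nE' sum_minn_sqr natrD.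
  by field.
have Wv : \sum_(i < n) deg i * m i v
    = v%:R * (v%:R - 1) + 2%:R * b%:R * v%:R + u%:R + v%:R.
  by rewrite (sum_deg_mul (m^~ v)) muv mvv nE sum_minn -/v; field.
(* [beta] vanishes at both glued vertices, so their extra degree adds nothing to [Wb] and [Wbb]. *)
have [bu bv] : (u - v = 0)%N /\ (v - v = 0)%N by rewrite /v; lia.
have Wb : \sum_(i < n) deg i * beta i = b%:R * (b%:R - 1).
  under eq_bigr do rewrite betaE //.
  by rewrite (sum_deg_mul (fun i => (i - v)%:R)) bu bv nE sum_subn !mulr0n; field.
have Wbb : \sum_(i < n) deg i * beta i ^+ 2
    = b%:R * (b%:R - 1) * (2%:R * b%:R - 1) / 3%:R.
  under eq_bigr do rewrite betaE //.
  rewrite (sum_deg_mul (fun i => (i - v)%:R ^+ 2)) bu bv nE sum_subn_sqr !mulr0n.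
  by field.
(* Twice the number [n + 1 = a + b + k - 1] of edges. *)
have vol : \sum_(i < n) deg i = 2%:R * n%:R + 2%:R.
  under eq_bigr do rewrite -[deg _]mulr1.
  by rewrite (sum_deg_mul (fun=> 1)) sumr_const card_ord; ring.
have b0 : b%:R != 0 :> algC by rewrite pnatr_eq0; lia.
have a0 : u.+1%:R != 0 :> algC by rewrite pnatr_eq0.
have tr : \sum_(i < n) deg i * green i i = \sum_(i < n) deg i * i%:R
    - (\sum_(i < n) deg i * m i u ^+ 2) / u.+1%:R
    - (\sum_(i < n) deg i * beta i ^+ 2) / b%:R.
  rewrite !mulr_suml -!sumrB; apply: eq_bigr => i _.
  by rewrite /green [m i i]/m minnn; ring.
rewrite kemeny_cb_green sum_green_deg tr vol W1 W2 Wu Wuu Wv Wb Wbb nE /v.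
(* [e1] and [e2] write the denominators met by [field], the edge count and the volume, as positive
   naturals. *)
have e1 : 1 + u%:R + b%:R + (1 + p%:R) - 1 = (u + p + b).+1%:R :> algC.
  by rewrite -natr1 !natrD; ring.
have e2 : 2%:R * (u%:R + p%:R + b%:R) + 2%:R = (2 * (u + p + b) + 2)%:R :> algC.
  by rewrite natrD natrM !natrD.
by rewrite !natrD; field; rewrite e1 e2 nat1r a0 b0 !pnatr_eq0 addn2.
Qed.

End Barbell.

Theorem theorem5p2 (a b k : nat) :
  (3 <= a)%N -> (3 <= b)%N -> (2 <= k)%N ->
  vertex_kemeny_cb k a b =
  ((a + b + k)%:R - 1)^-1 *
  ( (a%:R + 1) * (a%:R - 1) / 6%:R * (a%:R + 2%:R * (b%:R + k%:R - 1))
  + (b%:R + 1) * (b%:R - 1) / 6%:R * (b%:R + 2%:R * (a%:R + k%:R - 1))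
  + (a%:R + b%:R) * (k%:R - 1) ^+ 2
  + (k%:R - 1) * (2%:R * k%:R ^+ 2 - 4%:R * k%:R + 3%:R) / 6%:R
  + 2%:R * a%:R * b%:R * (k%:R - 1) : algC).
Proof.
case: a => [//|u]; case: k => [//|p]; rewrite !ltnS => u2 b3 p1.
exact: kemeny_cb_closed.
Qed.
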